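(* For any increasing function $g:\mathbb{R}^{+}\to\mathbb{Z}^{+}$ with $\lim_{r\to+\infty}g(r)=+\infty$, the metric space $X_{\omega}(g)=\mathrm{as}\bigsqcup_{i=1}^{\infty}(2^{\tilde g(i)}\mathbb{Z})^{g(i)}$, where $\tilde g(r)=\max\{k\in\mathbb{N} : ad_{(2^k\mathbb{Z})^{g(r)}}(r)=g(r)\}$, satisfies $X_{\omega}(g)\in\mathcal{D}_{\omega}$ and $ad_{X_{\omega}(g)}(r)\geq g(r)$ for every $r>0$.
   Context: $\mathbb{N}=\{1,2,3,\ldots\}$, $\mathbb{Z}^+$ is the set of positive integers; $\omega$ is the smallest infinite ordinal. ''Increasing'' means non-decreasing. Finite decomposition complexity. A metric family is a set of metric spaces; it is bounded if the diameters of its members are uniformly bounded. A single metric space $X$ is identified with the family $\{X\}$. For $r>0$, a metric family $\mathcal{X}$ is $r$-decomposable over a metric family $\mathcal{Y}$, written $\mathcal{X}\stackrel{r}{\rightarrow}\mathcal{Y}$, if every $X\in\mathcal{X}$ can be written $X=X_0\cup X_1$ where each $X_i$ ($i=0,1$) is a union $X_i=\bigsqcup_j X_{ij}$ of subspaces $X_{ij}\in\mathcal{Y}$ such that $d(X_{ij},X_{ij'})>r$ for $j\neq j'$. Let $\mathcal{D}_0$ be the collection of bounded families, and for an ordinal $\alpha>0$ let $\mathcal{D}_{\alpha}=\{\mathcal{X}:\forall r>0,\ \exists\beta<\alpha,\ \exists\mathcal{Y}\in\mathcal{D}_{\beta}\text{ such that }\mathcal{X}\stackrel{r}{\rightarrow}\mathcal{Y}\}$.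 Asymptotic dimension function. For a cover $\mathcal{U}$ of a metric space $X$, the Lebesgue number is $L(\mathcal{U})=\inf_{x\in X}\sup\{r>0:\exists U\in\mathcal{U},\ B(x,r)\subseteq U\}$, and the multiplicity $m(\mathcal{U})$ is the maximal number of elements of $\mathcal{U}$ with a nonempty intersection; $\mathcal{U}$ is uniformly bounded if $\sup\{\operatorname{diam}U:U\in\mathcal{U}\}<\infty$. Then $ad_X(\lambda)=\min\{m(\mathcal{U}):\mathcal{U}\text{ is a uniformly bounded cover of }X\text{ with }L(\mathcal{U})\geq\lambda\}-1$. Asymptotic union. For a sequence $\{Z_i\}_{i=1}^\infty$ of subspaces of a metric space $(Z,d_Z)$, the asymptotic union $\mathrm{as}\bigsqcup_{i=1}^{\infty}Z_i$ is the disjoint union of the $Z_i$ with the metric given, for $x$ in the $l$-th summand $Z_l$ and $y$ in the $k$-th summand $Z_k$ with $l\leq k$, by $d(x,y)=d_Z(x,y)+c$, where $c=0$ if $l=k$ and $c=l+(l+1)+\cdots+(k-1)$ if $l<k$. The spaces $(2^k\mathbb{Z})^n\subset\mathbb{R}^n$ carry the max metric, as subspaces of $(\bigoplus\mathbb{R},d_{\max})$, the finitely supported real sequences with the max metric ($\mathbb{R}^n$ being the sequences vanishing after the $n$-th coordinate).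
   Formalization: The bound ad(r) ≥ g(r) is claimed for r > 1 only, as it fails for 0 < r ≤ 1 (distinct points are at distance ≥ 1, so ad(r) = 0); the set defining g̃(1) and g̃(2) is empty, and its maximum is taken to be 0, so the first two summands are Z^{g(1)} and Z^{g(2)}. *)

(* Defs.v *)
From HB Require Import structures.
From mathcomp Require Import all_boot all_order all_algebra finmap.
From mathcomp Require Import all_classical all_reals all_analysis.
Import Order.TTheory GRing.Theory Num.Theory.
Import numFieldNormedType.Exports.

Set Implicit Arguments.
Unset Strict Implicit.
Unset Printing Implicit Defensive.

Local Open Scope classical_set_scope.
Local Open Scope ring_scope.

(* [submetric A] is [A] as a metric space in its own right. *)
Definition submetric (R : realType) (X : metricType R) (A : set X) : Type :=
  set_type A.

Section Submetric.
Context (R : realType) (X : metricType R) (A : set X).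

HB.instance Definition _ := Choice.copy (submetric A) (set_type A).

Let dist (x y : submetric A) : R := mdist (val x) (val y).

Let distxx x : dist x x = 0.
Proof. exact: mdistxx. Qed.

Let dist_positivity x y : dist x y = 0 -> x = y.
Proof. by move=> /mdist_positivity /val_inj. Qed.

Let dist_sym x y : dist x y = dist y x.
Proof. exact: metric_sym. Qed.

Let dist_triangle y x z : dist x z <= dist x y + dist y z.
Proof. exact: metric_triangle. Qed.

HB.instance Definition _ := isMetric.Build R (submetric A)
  distxx dist_positivity dist_sym dist_triangle.
End Submetric.

Section FiniteDecompositionComplexity.
Context {R : realType}.

Definition diam (X : metricType R) (A : set X) : \bar R :=
  ereal_sup [set (mdist p.1 p.2)%:E | p in A `*` A].

Definition set_dist (X : metricType R) (A B : set X) : \bar R :=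
  ereal_inf [set (mdist p.1 p.2)%:E | p in A `*` B].

(* Not [set (metricType R)], which is a universe inconsistency. *)
Definition metric_family : Type := metricType R -> Prop.

Definition single_family (X : metricType R) : metric_family := fun Y => Y = X.

Definition bounded_family (F : metric_family) : Prop :=
  (ereal_sup [set z | exists2 X : metricType R, F X & diam [set: X] = z]
     < +oo)%E.

(* The pieces X_ij are the members of the set P_i of subsets of X. *)
Definition decomposable (r : R) (F G : metric_family) : Prop :=
  forall X : metricType R, F X ->
  exists P : bool -> set (set X),
    [/\ [set: X] = \bigcup_(A in P false) A `|` \bigcup_(A in P true) A,
        forall i A, P i A -> G (submetric A) &
        forall i A B, P i A -> P i B -> A <> B -> (r%:E < set_dist A B)%E].

(* [fdc lt a F]: F belongs to D_a, where the ordinals are the elements of a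
   well-order (O, lt). *)
Inductive fdc (O : Type) (lt : O -> O -> Prop) : O -> metric_family -> Prop :=
| fdc_zero a F :
    (forall b, ~ lt b a) -> bounded_family F -> fdc lt a F
| fdc_pos a F :
    (exists b, lt b a) ->
    (forall r : R, 0 < r -> exists2 b, lt b a &
       exists2 G, fdc lt b G & decomposable r F G) ->
    fdc lt a F.

End FiniteDecompositionComplexity.

Arguments metric_family : clear implicits.

(* The ordinals up to omega: [Some n] is n and [None] is omega. *)
Definition lt_omega1 (a b : option nat) : Prop :=
  match a, b with
  | Some m, Some n => (m < n)%N
  | Some _, None => True
  | None, _ => False
  end.

Definition D_omega (R : realType) (F : metric_family R) : Prop :=
  fdc lt_omega1 None F.

Section AsymptoticDimension.
Context {R : realType} (X : metricType R).

Definition lebesgue_number (U : set (set X)) : \bar R :=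
  ereal_inf [set ereal_sup [set r%:E | r in
      [set r : R | 0 < r /\ exists2 A, U A & ball x r `<=` A]] | x in [set: X]].

(* The maximum with 0 only matters when X is empty. *)
Definition multiplicity (U : set (set X)) : \bar R :=
  maxe 0%E (ereal_sup [set (n%:R)%:E | n in [set n : nat |
    exists V : set (set X),
      [/\ V `<=` U, (V #= `I_n)%card & \bigcap_(A in V) A !=set0]]]).

Definition uniformly_bounded (U : set (set X)) : Prop :=
  (ereal_sup [set diam A | A in U] < +oo)%E.

(* Multiplicities lie in {0, 1, 2, ..., +oo}, so this infimum is a minimum. *)
Definition ad (lambda : R) : \bar R :=
  (ereal_inf [set multiplicity U | U in [set U : set (set X) |
     [/\ \bigcup_(A in U) A = [set: X], uniformly_bounded U &
         (lambda%:E <= lebesgue_number U)%E]]] - 1)%E.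

End AsymptoticDimension.

(* The disjoint union of the A i for i >= 1. *)
Definition as_union (R : realType) (Z : metricType R) (A : nat -> set Z) :
  Type := set_type [set p : nat * Z | (0 < p.1)%N /\ A p.1 p.2].

Definition as_gap (l k : nat) : nat := \sum_(minn l k <= j < maxn l k) j.

Lemma as_gapxx l : as_gap l l = 0%N.
Proof. by rewrite /as_gap minnn maxnn big_geq. Qed.

Lemma as_gap_sym l k : as_gap l k = as_gap k l.
Proof. by rewrite /as_gap minnC maxnC. Qed.

Lemma as_gap_gt0 l k : (0 < l)%N -> (0 < k)%N -> l != k -> (0 < as_gap l k)%N.
Proof.
move=> l0 k0; rewrite neq_ltn /as_gap => /orP[] lk.
- by rewrite (minn_idPl (ltnW lk)) (maxn_idPr (ltnW lk)) big_ltn// addn_gt0 l0.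
- by rewrite (minn_idPr (ltnW lk)) (maxn_idPl (ltnW lk)) big_ltn// addn_gt0 k0.
Qed.

Lemma as_gap_triangle l k m : (as_gap l m <= as_gap l k + as_gap k m)%N.
Proof.
pose T n := (\sum_(0 <= j < n) j)%N.
have TE a b : (a <= b)%N -> (T b = T a + as_gap a b)%N.
  by move=> ab; rewrite /T /as_gap (minn_idPl ab) (maxn_idPr ab)
    (big_cat_nat _ ab).
have TE' a b : (T a <= T b + as_gap a b)%N.
  have [/TE->|/ltnW/TE->] := leqP a b; first by rewrite -addnA leq_addr.
  by rewrite as_gap_sym.
have [/TE lm|/ltnW/TE lm] := leqP l m.
- rewrite -(leq_add2l (T l)) -lm addnA.
  apply: leq_trans (TE' m k) _; rewrite (as_gap_sym m k) leq_add2r.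
  by rewrite (as_gap_sym l k) TE'.
- rewrite (as_gap_sym l m) -(leq_add2l (T m)) -lm addnCA addnC.
  apply: leq_trans (TE' l k) _; rewrite leq_add2r.
  exact: TE'.
Qed.

Section AsUnion.
Context (R : realType) (Z : metricType R) (A : nat -> set Z).

HB.instance Definition _ := Choice.copy (as_union A)
  (set_type [set p : nat * Z | (0 < p.1)%N /\ A p.1 p.2]).

Let dist (x y : as_union A) : R :=
  mdist (val x).2 (val y).2 + (as_gap (val x).1 (val y).1)%:R.

Let distxx x : dist x x = 0.
Proof. by rewrite /dist mdistxx as_gapxx addr0. Qed.

Let dist_positivity x y : dist x y = 0 -> x = y.
Proof.
case: x y => [[l u] xA] [[k v] yA] /eqP; rewrite /dist /= paddr_eq0 ?mdist_ge0//.
move=> /andP[/eqP /mdist_positivity uv]; rewrite pnatr_eq0 => /eqP gap0.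
have [/= l0 _] := set_mem xA; have [/= k0 _] := set_mem yA.
apply: val_inj; congr (_, _) => //=; apply/eqP/negPn/negP => lk.
by have := as_gap_gt0 l0 k0 lk; rewrite gap0.
Qed.

Let dist_sym x y : dist x y = dist y x.
Proof. by rewrite /dist metric_sym as_gap_sym. Qed.

Let dist_triangle y x z : dist x z <= dist x y + dist y z.
Proof.
rewrite /dist addrACA lerD ?metric_triangle// -natrD ler_nat.
exact: as_gap_triangle.
Qed.

HB.instance Definition _ := isMetric.Build R (as_union A)
  distxx dist_positivity dist_sym dist_triangle.
End AsUnion.

(* Finitely supported sequences with the max metric, coordinates starting at 0. *)
Definition Rfin (R : realType) : Type := {fsfun nat -> R with 0}.

Section Rfin.
Context (R : realType).

HB.instance Definition _ :=
  Choice.copy (Rfin R) {fsfun nat -> R with 0}.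

Let coord (u : Rfin R) (i : nat) : R := (u : {fsfun nat -> R with 0}) i.

Let dist (u v : Rfin R) : R :=
  \big[Num.max/0]_(i <- (finsupp u `|` finsupp v)%fset) `|coord u i - coord v i|.

Let dist_le u v i : `|coord u i - coord v i| <= dist u v.
Proof.
have [iuv|] := boolP (i \in (finsupp u `|` finsupp v)%fset).
  exact: (@le_bigmax_seq _ R _ _ 0 i xpredT
    (fun j => `|coord u j - coord v j|) iuv isT).
rewrite in_fsetU negb_or => /andP[iu iv].
rewrite /coord !fsfun_dflt// subrr normr0.
exact: bigmax_ge_id.
Qed.

Let dist_leP u v (e : R) : 0 <= e ->
  (forall i, `|coord u i - coord v i| <= e) -> dist u v <= e.
Proof.
by move=> e0 uve; apply: bigmax_le.
Qed.

Let dist_ge0 u v : 0 <= dist u v.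
Proof. exact: le_trans (normr_ge0 _) (dist_le u v 0). Qed.

Let distxx u : dist u u = 0.
Proof.
apply/eqP; rewrite eq_le dist_ge0 andbT dist_leP// => i.
by rewrite subrr normr0.
Qed.

Let dist_positivity u v : dist u v = 0 -> u = v.
Proof.
move=> uv0; apply/fsfunP => i; apply/eqP.
by have := dist_le u v i; rewrite uv0 normr_le0 subr_eq0.
Qed.

Let dist_sym u v : dist u v = dist v u.
Proof.
by rewrite /dist fsetUC; apply: eq_bigr => i _; rewrite distrC.
Qed.

Let dist_triangle v u w : dist u w <= dist u v + dist v w.
Proof.
apply: dist_leP => [|i]; first by rewrite addr_ge0.
by rewrite (le_trans (ler_distD (coord v i) _ _))// lerD.
Qed.

HB.instance Definition _ := isMetric.Build R (Rfin R)
  distxx dist_positivity dist_sym dist_triangle.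
End Rfin.

(* (2^k Z)^n *)
Definition lattice (R : realType) (k n : nat) : set (Rfin R) :=
  [set u : {fsfun nat -> R with 0} |
    (forall i, (i < n)%N -> exists m : int, u i = 2 ^+ k * m%:~R) /\
    (forall i, (n <= i)%N -> u i = 0)].

Arguments lattice R k n : clear implicits.

Section XOmega.
Context {R : realType} (g : R -> nat).

(* For r > 0 and g r > 0, the set S is empty exactly when r <= 2; the maximum is
   then 0 by convention, which affects only the first two summands of X_omega. *)
Definition gtilde (r : R) : nat :=
  let S := [set k : nat | (0 < k)%N /\
    ad (submetric (lattice R k (g r))) r = ((g r)%:R)%:E] in
  xget 0%N [set k | S k /\ ubound S k].

(* Distinct points of X_omega are at distance at least 1, so [ad X_omega r] is 0
   for 0 < r <= 1 and can be bounded below by g r only when r > 1. *)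
Definition X_omega : Type :=
  as_union (fun i : nat => lattice R (gtilde i%:R) (g i%:R)).

HB.instance Definition _ := Metric.on X_omega.

End XOmega.

(* Main.v *)
Require Import Defs.
From mathcomp Require Import all_boot all_order all_algebra finmap all_fingroup.
From mathcomp Require Import all_classical all_reals all_analysis.
From mathcomp Require Import zify lra ring.
Import Order.TTheory GRing.Theory Num.Theory.
Import numFieldNormedType.Exports.

Set Implicit Arguments.
Unset Strict Implicit.
Unset Printing Implicit Defensive.

Local Open Scope ring_scope.

(** Write [L k n] for the lattice of step [2 ^ k] in dimension [n]. Everything
    rests on the value of its asymptotic dimension function: for [n > 0] and
    [r > 0], [ad (L k n) r = n] exactly when [2 ^ k < r] ([ad_latticeP]).

    The upper bound [n] ([ad_lattice_le]) comes from superposing [n + 1]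
    shifted tilings of space by large cubes. Each coordinate of a point is
    close to the walls of at most one of these tilings, so some tiling keeps
    the whole [r]-ball around the point inside one tile. When [r <= 2 ^ k],
    open [r]-balls are points, and the cover by singletons gives [ad = 0].

    The lower bound ([multiplicity_grid]) is a discrete form of the Lebesgue
    covering theorem. Given a uniformly bounded cover of Lebesgue number
    larger than the step [s] of a grid, colour every grid point by a member of
    the cover containing the closed [s]-ball around it. The vertices of a unit
    cube all lie in the members that colour any of them, so it suffices to
    find a unit cube showing [n + 1] colours. On a box too large for a colour
    to join two opposite faces, labelling a point by the first coordinate
    whose zero face its colour misses meets the boundary conditions of Kuhn's
    cubical version of Sperner's lemma ([kuhn_lemma]), which yields a simplex
    with [n + 1] distinct labels. Kuhn's lemma is proved with determinants:
    the signed sum, over all simplices of Kuhn's triangulation, of the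
    determinant of the indicators of the labels cancels along interior facets,
    and the boundary conditions reduce it, up to sign, to the same sum over
    one face; by induction it is nonzero.

    Consequently [gtilde i] is the largest [k] with [2 ^ k < i] once [i >= 3].
    It tends to infinity, so at any given scale [r] the space [X_omega g]
    consists of finitely many summands and of a remainder whose points are
    pairwise more than [r] apart. The finitely many summands embed in a
    finite-dimensional space up to a bounded error, and cutting into slabs
    along one coordinate after another puts them in a finite stage of the
    hierarchy ([fdc_coordinatized]); this gives membership in the stage omega.
    For the growth of [ad], given [r > 1], let [i] be the least integer with
    [r <= i]. Then [2 ^ gtilde i <= i - 1 < r], so the [i]-th summand forces
    [ad r] to be at least [g i], hence at least [g r]. *)

(** * Kuhn's lemma *)

(** The vertices, for [j = 0, ..., n], of the simplex of Kuhn's triangulation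
    that starts at [x] and increments coordinate [k] at time [s k]. The points
    are sequences, with coordinates from [n] on given by [b], so that a face
    of a box is a box of smaller dimension in the same space: this is what
    lets the induction on [n] keep the same labelling. *)
Definition kuhn_vertex n N (b : nat -> nat) (x : {ffun 'I_n -> 'I_N})
    (s : 'S_n) (j i : nat) : nat :=
  if insub i is Some k then (x k + (s k < j))%N else b i.

Lemma kuhn_vertexE n N b (x : {ffun 'I_n -> 'I_N}) s j (k : 'I_n) :
  kuhn_vertex b x s j k = (x k + (s k < j))%N.
Proof. by rewrite /kuhn_vertex valK. Qed.

Lemma kuhn_vertex_out n N b (x : {ffun 'I_n -> 'I_N}) s j i :
  (n <= i)%N -> kuhn_vertex b x s j i = b i.
Proof. by move=> ni; rewrite /kuhn_vertex insubF// ltnNge ni. Qed.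

Lemma kuhn_vertex_close n N b (x : {ffun 'I_n -> 'I_N}) s j i : (i < n)%N ->
  (kuhn_vertex b x s 0 i <= kuhn_vertex b x s j i <=
   (kuhn_vertex b x s 0 i).+1)%N.
Proof.
move=> ni; rewrite -[i]/(val (Ordinal ni)) !kuhn_vertexE; lia.
Qed.

Section Kuhn.
Variables (l : (nat -> nat) -> nat) (N : nat).

Definition label_mx n (v : nat -> nat -> nat) : 'M[int]_n.+1 :=
  \matrix_(i, j) (l (v j) == i)%:R.

(** On labels [0, ..., n] the indicators add up to 1, so the last one may be
    replaced by the constant 1 without changing the determinant. The constant
    row makes the determinant of a simplex the alternating sum of the
    determinants of its facets, as for a boundary operator. *)
Definition label1_mx n (v : nat -> nat -> nat) : 'M[int]_n.+1 :=
  \matrix_(i, j) if i == ord_max then 1 else (l (v j) == i)%:R.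

Lemma det_label1_mxE n (v : nat -> nat -> nat) :
  (forall j : 'I_n.+1, (l (v j) <= n)%N) ->
  \det (label1_mx n v) = \det (label_mx n v).
Proof.
move=> ln; pose E : 'M[int]_n.+1 :=
  \matrix_(i, j) ((i == j) || (i == ord_max))%:R.
(* the row operation adding every row to the last one *)
have -> : label1_mx n v = E *m label_mx n v.
  apply/matrixP => i j; rewrite !mxE.
  rewrite (bigD1 (Ordinal (ln j : (l (v j) < n.+1)%N)))//=.
  rewrite big1 => [|k kj]; last first.
    rewrite !mxE -[_ == _ :> nat]/(_ == k :> nat).
    case: (l (v j) =P k) => [ljk|]; last by rewrite mulr0.
    by case/eqP: kj; apply: val_inj.
  rewrite !mxE eqxx mulr1 addr0.
  case: (i =P ord_max) => [->|_]; first by rewrite orbT.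
  by rewrite orbF eq_sym.
rewrite det_mulmx det_trig ?big1 ?mul1r// => [i _|]; first by rewrite mxE eqxx.
apply/is_trig_mxP => i j ij; rewrite mxE -val_eqE (ltn_eqF ij)/=.
by rewrite -val_eqE ltn_eqF// (leq_trans ij)// -ltnS.
Qed.

Definition facet_mx n (v : nat -> nat -> nat) (p : nat) : 'M[int]_n :=
  \matrix_(i, j) (l (v (bump p j)) == i)%:R.

Lemma det_label1_facet n v : \det (label1_mx n v) =
  \sum_(p < n.+1) (-1) ^+ (n + p) * \det (facet_mx n v p).
Proof.
rewrite (expand_det_row _ ord_max); apply: eq_bigr => p _.
rewrite mxE eqxx mul1r /cofactor/=; congr (_ * \det _).
apply/matrixP => i j; rewrite !mxE/= -val_eqE /= /bump leqNgt ltn_ord/= add0n.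
by rewrite ltn_eqF.
Qed.

Lemma bump_ord_le n p (j : 'I_n) : (bump p j <= n)%N.
Proof. by rewrite /bump; have := ltn_ord j; lia. Qed.

Lemma facet_mxE n (v w : nat -> nat -> nat) p :
  (forall j i, (j <= n)%N -> j != p -> v j i = w j i) ->
  facet_mx n v p = facet_mx n w p.
Proof.
move=> vw; apply/matrixP => i j; rewrite !mxE; congr (l _ == _)%:R.
by apply/funext => k; apply: vw; rewrite ?bump_ord_le// eq_sym neq_bump.
Qed.

Lemma det_facet0 n (v : nat -> nat -> nat) p (k : 'I_n) :
  (forall j, (j <= n)%N -> j != p -> l (v j) != k) ->
  \det (facet_mx n v p) = 0.
Proof.
move=> vk; rewrite (expand_det_row _ k) big1// => j _.
by rewrite mxE (negbTE (vk _ _ _)) ?mul0r ?bump_ord_le// eq_sym neq_bump.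
Qed.

Local Notation kv := (@kuhn_vertex _ N.+1).

Definition facet_sum n b p := \sum_(s : 'S_n) \sum_(x : {ffun 'I_n -> 'I_N.+1})
  (-1) ^+ s * \det (facet_mx n (kv b x s) p).

Definition kuhn_sum n b := \sum_(s : 'S_n) \sum_(x : {ffun 'I_n -> 'I_N.+1})
  (-1) ^+ s * \det (label1_mx n (kv b x s)).

Lemma kuhn_sum_facet n b :
  kuhn_sum n b = \sum_(p < n.+1) (-1) ^+ (n + p) * facet_sum n b p.
Proof.
under [RHS]eq_bigr do rewrite big_distrr/=.
rewrite exchange_big; apply: eq_bigr => s _/=.
under [RHS]eq_bigr do rewrite big_distrr/=.
rewrite exchange_big; apply: eq_bigr => x _/=.
rewrite det_label1_facet big_distrr; apply: eq_bigr => p _/=.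
by rewrite mulrCA.
Qed.

(** Exchanging two consecutive increments moves only the vertex [p] between
    them and reverses the orientation: the two simplices on either side of the
    facet opposite to [p] cancel. *)
Lemma facet_sum_mid n b p : (0 < p < n)%N -> facet_sum n b p = 0.
Proof.
case/andP=> p0 pn.
have pn' : (p.-1 < n)%N by rewrite (leq_ltn_trans _ pn)// leq_pred.
pose t : 'S_n := tperm (Ordinal pn') (Ordinal pn).
have ot : odd_perm t by rewrite odd_tperm -val_eqE/= neq_ltn prednK// leqnn.
suff : facet_sum n b p = - facet_sum n b p.
  by move/eqP; rewrite -subr_eq0 opprK -mulr2n mulrn_eq0 => /eqP.
rewrite {1}/facet_sum (reindex_inj (mulIg t)) /facet_sum/=.
rewrite -sumrN; apply: eq_bigr => s _; rewrite -sumrN; apply: eq_bigr => x _.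
rewrite odd_permM ot addbT signrN mulNr; congr (- (_ * \det _)).
apply: facet_mxE => j i jn jp; rewrite /kuhn_vertex.
case: insubP => // k _ _; rewrite permM; congr (_ + nat_of_bool _)%N.
rewrite /t; case: tpermP => [->|->|]//=; move: jp p0; clear; lia.
Qed.

(** Wrapping around the box makes this move of the base point a bijection; the
    wrapped base points are treated apart. *)
Definition cyc_shift n (k : 'I_n) (x : {ffun 'I_n -> 'I_N.+1}) :
    {ffun 'I_n -> 'I_N.+1} := [ffun i => if i == k then ordS (x i) else x i].

Lemma cyc_shift_inj n (k : 'I_n) : injective (cyc_shift k).
Proof.
move=> x y /ffunP xy; apply/ffunP => i; have := xy i.
by rewrite !ffunE; case: ifP => // _; apply: ordS_inj.
Qed.

(** The cycle [0 -> m -> m - 1 -> ... -> 1 -> 0], which turns the first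
    increment of a simplex into its last one. *)
Definition rot_perm m : 'S_m.+1 := lift_perm ord0 ord_max 1.

Lemma rot_perm_val m (i : 'I_m.+1) :
  rot_perm m i = (if i == ord0 then m else i.-1) :> nat.
Proof.
rewrite /rot_perm; case: (unliftP ord0 i) => [j|] ->.
  by rewrite lift_perm_lift perm1; have := ltn_ord j; rewrite /= /bump; lia.
by rewrite lift_perm_id eqxx.
Qed.

Definition first_dir m (s : 'S_m.+1) : 'I_m.+1 := (s^-1)%g ord0.

(** The facet opposite to the first vertex of a simplex is the facet opposite
    to the last vertex of the next simplex, unless it lies in the far face of
    the box. *)
Lemma facet_mx_shift m b (x : {ffun 'I_m.+1 -> 'I_N.+1}) (s : 'S_m.+1) :
  x (first_dir s) != ord_max ->
  facet_mx m.+1 (kv b (cyc_shift (first_dir s) x) (s * rot_perm m)%g) m.+1 =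
  facet_mx m.+1 (kv b x s) 0.
Proof.
move=> xN; apply/matrixP => i j; rewrite !mxE; congr (l _ == _)%:R.
apply/funext => k; rewrite /kuhn_vertex; case: insubP => // {}k _ _.
rewrite permM rot_perm_val ffunE.
have -> : bump m.+1 j = j by rewrite /bump leqNgt ltn_ord.
have -> : bump 0 j = j.+1 by [].
case: (k =P first_dir s) => [->|/eqP ks].
  rewrite /first_dir permKV eqxx/= -/(first_dir s).
  move: xN; rewrite -val_eqE /= => xN; rewrite modn_small; last first.
    by have := ltn_ord (x (first_dir s)); lia.
  by have := ltn_ord j; lia.
have sk : s k != ord0.
  by apply: contra ks => /eqP sk; rewrite /first_dir -sk permK.
rewrite (negbTE sk); move: sk; rewrite -val_eqE/=; lia.
Qed.

(** Kuhn's boundary conditions on the face of the box [0, ..., N + 1]^n whose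
    remaining coordinates are those of [b]. *)
Definition kuhn_labelling n b : Prop := forall v : nat -> nat,
  (forall i, (i < n)%N -> (v i <= N.+1)%N) ->
  (forall i, (n <= i)%N -> v i = b i) ->
  (l v <= n)%N /\
  forall i, (i < n)%N ->
    (v i = 0%N -> l v <> i) /\ (v i = N.+1 -> (l v <= i)%N).

Lemma kuhn_labelling_vertex n b (x : {ffun 'I_n -> 'I_N.+1}) (s : 'S_n) j :
  kuhn_labelling n b ->
  (l (kv b x s j) <= n)%N /\
  forall k : 'I_n, (kv b x s j k = 0%N -> l (kv b x s j) != k) /\
    (kv b x s j k = N.+1 -> (l (kv b x s j) <= k)%N).
Proof.
move=> lb; have [|i ni|ln lk] := lb (kv b x s j).
- move=> i ni; rewrite -[i]/(val (Ordinal ni)) kuhn_vertexE.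
  by have := ltn_ord (x (Ordinal ni)); lia.
- exact: kuhn_vertex_out.
- split=> // k; have [k0 kN] := lk k (ltn_ord k).
  by split=> // /k0/eqP.
Qed.

(** The wrapped facet lies in a zero face; the label of that face is missing
    from it, so its matrix has a zero row. *)
Lemma det_facet_wrap m b (x : {ffun 'I_m.+1 -> 'I_N.+1}) (s : 'S_m.+1) :
  kuhn_labelling m.+1 b -> x (first_dir s) = ord_max ->
  \det (facet_mx m.+1
    (kv b (cyc_shift (first_dir s) x) (s * rot_perm m)%g) m.+1) = 0.
Proof.
move=> lb xN; apply: (@det_facet0 _ _ _ (first_dir s)) => j jm jneq.
have [_ /(_ (first_dir s))[+ _]] :=
  kuhn_labelling_vertex (cyc_shift (first_dir s) x) (s * rot_perm m)%g j lb.
apply; rewrite kuhn_vertexE ffunE eqxx xN /= modnn add0n.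
rewrite permM rot_perm_val /first_dir permKV eqxx; lia.
Qed.

(** Only the facets in the far faces of the box survive the cancellation. *)
Lemma kuhn_sum_top m b : kuhn_labelling m.+1 b -> kuhn_sum m.+1 b =
  (-1) ^+ m.+1 * \sum_(s : 'S_m.+1)
    \sum_(x : {ffun 'I_m.+1 -> 'I_N.+1} | x (first_dir s) == ord_max)
    (-1) ^+ s * \det (facet_mx m.+1 (kv b x s) 0).
Proof.
move=> lb; rewrite kuhn_sum_facet big_ord_recl big_ord_recr /=.
rewrite [X in _ + (X + _)]big1 => [|p _]; last first.
  by rewrite facet_sum_mid ?mulr0// /bump/=; have := ltn_ord p; lia.
rewrite add0r addn0 [bump 0 _]/bump/= add1n.
(* the facets opposite to the last vertex, indexed from the simplex behind *)
have -> : facet_sum m.+1 b m.+1 = (-1) ^+ m * \sum_(s : 'S_m.+1)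
    \sum_(x : {ffun 'I_m.+1 -> 'I_N.+1} | x (first_dir s) != ord_max)
    (-1) ^+ s * \det (facet_mx m.+1 (kv b x s) 0).
  rewrite /facet_sum (reindex_inj (mulIg (rot_perm m))) /= big_distrr/=.
  apply: eq_bigr => s _.
  rewrite (reindex_inj (@cyc_shift_inj _ (first_dir s)))/=.
  rewrite (bigID (fun x : {ffun 'I_m.+1 -> 'I_N.+1} =>
    x (first_dir s) == ord_max)) /=.
  rewrite big1 ?add0r => [|x /eqP xN]; last by rewrite det_facet_wrap ?mulr0.
  rewrite big_distrr; apply: eq_bigr => x xN /=; rewrite facet_mx_shift//.
  rewrite odd_permM /rot_perm odd_lift_perm odd_perm1/= addbF signr_addb.
  by rewrite signr_odd mulrA [_ * (-1) ^+ s]mulrC.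
have -> : facet_sum m.+1 b 0 =
    \sum_(s : 'S_m.+1)
      \sum_(x : {ffun 'I_m.+1 -> 'I_N.+1} | x (first_dir s) == ord_max)
        (-1) ^+ s * \det (facet_mx m.+1 (kv b x s) 0) +
    \sum_(s : 'S_m.+1)
      \sum_(x : {ffun 'I_m.+1 -> 'I_N.+1} | x (first_dir s) != ord_max)
        (-1) ^+ s * \det (facet_mx m.+1 (kv b x s) 0).
  by rewrite -big_split; apply: eq_bigr => s _; exact: bigID.
rewrite mulrDr -addrA -[RHS]addr0; congr (_ + _); rewrite mulrA -mulrDl.
by rewrite addnn -mul2n exprM sqrrN !expr1n mul1r exprS mulN1r addNr mul0r.
Qed.

Definition extend_top m (y : {ffun 'I_m -> 'I_N.+1}) :
    {ffun 'I_m.+1 -> 'I_N.+1} :=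
  [ffun i => oapp y ord_max (unlift ord_max i)].

Definition top_face m (b : nat -> nat) (i : nat) :=
  if i == m then N.+1 else b i.

Lemma kuhn_labelling_top m b :
  kuhn_labelling m.+1 b -> kuhn_labelling m (top_face m b).
Proof.
move=> lb v vN vb; have vm : v m = N.+1 by rewrite vb// /top_face eqxx.
have [i|i mi|lm li] := lb v.
- by rewrite ltnS leq_eqVlt => /predU1P[->|/vN//]; rewrite vm.
- by rewrite vb ?(ltnW mi)// /top_face gtn_eqF.
- by split=> [|i im]; [exact: (li m _).2 | apply: li; rewrite ltnS ltnW].
Qed.

Lemma facet_top m b (y : {ffun 'I_m -> 'I_N.+1}) (t : 'S_m) :
  facet_mx m.+1 (kv b (extend_top y) (lift_perm ord_max ord0 t)) 0 =
  label_mx m (kv (top_face m b) y t).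
Proof.
apply/matrixP => i j; rewrite !mxE; congr (l _ == _)%:R; apply/funext => k.
have -> : bump 0 j = j.+1 by [].
have [km|km] := ltnP k m.+1; last first.
  by rewrite !kuhn_vertex_out// 1?ltnW// /top_face gtn_eqF.
rewrite -[k in LHS]/(val (Ordinal km)) kuhn_vertexE ffunE.
case: (unliftP ord_max (Ordinal km)) => [h|] E.
  have kh : k = h by have /(congr1 val) := E; rewrite /= /bump leqNgt ltn_ord.
  by rewrite E /= lift_perm_lift kh kuhn_vertexE.
have km' : k = m by have /(congr1 val) := E.
rewrite E /= lift_perm_id kuhn_vertex_out; last by rewrite km'.
by rewrite /top_face km' eqxx addn1.
Qed.

End Kuhn.

(** The permutations sending [i] to [j] are the lifts of the permutations of
    one fewer element; this identifies the simplices resting on the last far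
    face with the simplices of that face. *)
Lemma lift_perm_onto m (i j : 'I_m.+1) (s : 'S_m.+1) : s i = j ->
  exists t, s = lift_perm i j t.
Proof.
move=> sij; pose f k := odflt k (unlift j (s (lift i k))).
have fE k : lift j (f k) = s (lift i k).
  rewrite /f; case: unliftP => //= sk.
  by have := neq_lift i k; rewrite -(inj_eq (@perm_inj _ s)) sij sk eqxx.
have f_inj : injective f.
  by move=> k h /(congr1 (lift j)); rewrite !fE => /perm_inj/lift_inj.
exists (perm f_inj); apply/permP => k; case: (unliftP i k) => [h|] ->.
  by rewrite lift_perm_lift permE fE.
by rewrite lift_perm_id.
Qed.

Lemma lift_perm_inj m (i j : 'I_m.+1) : injective (@lift_perm m i j).
Proof.
move=> s t /permP st; apply/permP => k; apply: (@lift_inj _ j).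
by rewrite -!(lift_perm_lift i) st.
Qed.

Lemma sum_lift_perm m (i j : 'I_m.+1) (F : 'S_m.+1 -> int) :
  \sum_(s : 'S_m.+1 | s i == j) F s = \sum_t F (lift_perm i j t).
Proof.
transitivity (\sum_(s in [set lift_perm i j t | t in [set: 'S_m]]) F s).
  apply: eq_bigl => s; apply/eqP/imsetP => [/lift_perm_onto[t ->]|[t _ ->]].
    by exists t; rewrite ?inE.
  by rewrite lift_perm_id.
rewrite big_imset /=; first by apply: eq_bigl => t; rewrite inE.
by move=> s t _ _; apply: lift_perm_inj.
Qed.

Lemma extend_top_inj N m : injective (@extend_top N m).
Proof.
move=> y z /ffunP yz; apply/ffunP => i; have := yz (lift ord_max i).
by rewrite !ffunE liftK.
Qed.

Lemma sum_extend_top N m (F : {ffun 'I_m.+1 -> 'I_N.+1} -> int) :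
  \sum_(x : {ffun 'I_m.+1 -> 'I_N.+1} | x ord_max == ord_max) F x =
  \sum_y F (extend_top y).
Proof.
pose yT := [set: {ffun 'I_m -> 'I_N.+1}].
transitivity (\sum_(x in [set extend_top y | y in yT]) F x).
  apply: eq_bigl => x; apply/eqP/imsetP => [xm|[y _ ->]]; last first.
    by rewrite ffunE unlift_none.
  exists [ffun i => x (lift ord_max i)]; rewrite ?inE//; apply/ffunP => i.
  by rewrite ffunE; case: unliftP => [j|] ->//=; rewrite ffunE.
rewrite big_imset /=; first by apply: eq_bigl => y; rewrite inE.
by move=> y z _ _; apply: extend_top_inj.
Qed.

Section KuhnLemma.
Variables (l : (nat -> nat) -> nat) (N : nat).

(** Among the far faces only the last one contributes: on the far face of
    another coordinate [k] no label exceeds [k], so label [m] does not occur.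
    *)
Lemma kuhn_sum_rec m b : kuhn_labelling l N m.+1 b ->
  kuhn_sum l N m.+1 b = - kuhn_sum l N m (top_face N m b).
Proof.
move=> lb; rewrite kuhn_sum_top//.
rewrite (bigID (fun s : 'S_m.+1 => s ord_max == ord0))/=.
rewrite [X in _ + X]big1 ?addr0 => [|s sm]; last first.
  apply: big1 => x /eqP xs.
  rewrite (@det_facet0 _ _ _ _ ord_max) ?mulr0// => j jm j0.
  have [_ /(_ (first_dir s))[_]] := kuhn_labelling_vertex x s j lb.
  rewrite kuhn_vertexE xs /first_dir permKV lt0n j0 addn1 => /(_ erefl) lk.
  have : (s^-1)%g ord0 != ord_max.
    by apply: contra sm => /eqP <-; rewrite permKV.
  rewrite -val_eqE/= => km; have := ltn_ord ((s^-1)%g ord0).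
  by rewrite neq_ltn; move: lk km; set k := nat_of_ord _; lia.
rewrite sum_lift_perm /kuhn_sum big_distrr -sumrN; apply: eq_bigr => t _ /=.
have -> : first_dir (lift_perm ord_max ord0 t) = ord_max.
  by rewrite /first_dir lift_permV lift_perm_id.
rewrite sum_extend_top big_distrr -sumrN; apply: eq_bigr => y _ /=.
rewrite facet_top// det_label1_mxE => [|j]; last first.
  exact: (kuhn_labelling_vertex y t j (kuhn_labelling_top lb)).1.
rewrite odd_lift_perm addbF signr_addb signr_odd !mulrA exprS mulN1r -signr_odd.
by rewrite !mulNr -!signr_addb addbb.
Qed.

Lemma kuhn_sum_neq0 n b : kuhn_labelling l N n b -> kuhn_sum l N n b != 0.
Proof.
elim: n b => [|n IHn] b lb; last first.
  by rewrite kuhn_sum_rec// oppr_eq0 IHn//; apply: kuhn_labelling_top.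
rewrite /kuhn_sum (big_pred1 1%g) => [|s]; last first.
  by apply/esym/eqP/permP => -[].
rewrite (big_pred1 [ffun=> ord0]) => [|x]; last first.
  by apply/esym/eqP/ffunP => -[].
by rewrite odd_perm1 mul1r det_mx11 mxE.
Qed.

(** A simplex with a repeated label has two equal columns, so a nonzero sum
    forces the existence of a simplex with distinct labels. *)
Theorem kuhn_lemma n b : kuhn_labelling l N n b ->
  exists (x : {ffun 'I_n -> 'I_N.+1}) (s : 'S_n),
    injective (fun j : 'I_n.+1 => l (kuhn_vertex b x s j)).
Proof.
move=> /kuhn_sum_neq0 nz.
pose inj (x : {ffun 'I_n -> 'I_N.+1}) (s : 'S_n) :=
  injectiveb (fun j : 'I_n.+1 => l (kuhn_vertex b x s j)).
have [/existsP[x /existsP[s /injectiveP]]|noinj] :=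
    boolP [exists x : {ffun 'I_n -> 'I_N.+1}, exists s, inj x s].
  by exists x, s.
case/eqP: nz; apply: big1 => s _; apply: big1 => x _; rewrite -det_tr.
have /injectivePn[i [j ij lij]] : ~~ inj x s.
  apply: contra noinj => xs.
  by apply/existsP; exists x; apply/existsP; exists s.
rewrite (determinant_alternate ij) ?mulr0// => k; rewrite !mxE.
by case: ifP => // _; rewrite lij.
Qed.

End KuhnLemma.

(** * Covers of metric spaces *)

Local Open Scope classical_set_scope.

Section Covers.
Context {R : realType} (X : metricType R).
Implicit Types (U V : set (set X)).

Lemma diam_leP (A : set X) (D : R) :
  (diam A <= D%:E)%E <-> (forall p q, A p -> A q -> mdist p q <= D).
Proof.
split=> [AD p q Ap Aq|AD]; last first.
  by apply: ge_ereal_sup => _ [[p q] [/= Ap Aq] <-]; rewrite lee_fin AD.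
rewrite -lee_fin; apply: le_trans AD.
by apply: ereal_sup_ubound; exists (p, q).
Qed.

Lemma uniformly_boundedP U : uniformly_bounded U <->
  exists D : R, forall A, U A -> forall p q, A p -> A q -> mdist p q <= D.
Proof.
split=> [Ub|[D UD]]; last first.
  apply: (@le_lt_trans _ _ D%:E); last exact: ltry.
  by apply: ge_ereal_sup => _ [A UA <-]; apply/diam_leP; apply: UD.
have [D UD] : exists D : R, (ereal_sup [set diam A | A in U] <= D%:E)%E.
  move: Ub; rewrite /uniformly_bounded; case: (ereal_sup _) => [D _|//|_].
    by exists D.
  by exists 0; rewrite leNye.
exists D => A UA; apply/diam_leP; apply: le_trans UD.
by apply: ereal_sup_ubound; exists A.
Qed.

(** The strict inequality turns open balls of radius close to [lambda] into
    closed balls of radius [s]. *)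
Lemma lebesgue_number_gt U (s lambda : R) :
  s < lambda -> (lambda%:E <= lebesgue_number U)%E ->
  forall p, exists2 A, U A & forall q, mdist p q <= s -> A q.
Proof.
move=> sl lU p; have : (s%:E < ereal_sup [set r%:E | r in
    [set r : R | (0 < r)%R /\ exists2 A, U A & ball p r `<=` A]])%E.
  apply: (@lt_le_trans _ _ lambda%:E); first by rewrite lte_fin.
  by apply: (le_trans lU); apply: ereal_inf_lbound; exists p.
case/ereal_sup_gt => _ [r [r0 [A UA rA]] <-]; rewrite lte_fin => sr.
exists A => // q pq; apply: rA; rewrite ballEmdist/=.
exact: le_lt_trans sr.
Qed.

Lemma lebesgue_number_ge U (lambda : R) : 0 < lambda ->
  (forall p, exists2 A, U A & forall q, mdist p q < lambda -> A q) ->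
  (lambda%:E <= lebesgue_number U)%E.
Proof.
move=> l0 lU; apply: le_ereal_inf_tmp => _ [p _ <-].
apply: ereal_sup_ubound; exists lambda => //; split=> //.
by have [A UA pA] := lU p; exists A => // q; rewrite ballEmdist => /pA.
Qed.

Lemma multiplicity_ge U n (c : 'I_n -> set X) p :
  injective c -> (forall j, U (c j)) -> (forall j, c j p) ->
  ((n%:R)%:E <= multiplicity U)%E.
Proof.
move=> c_inj Uc cp; rewrite /multiplicity le_max; apply/orP; right.
apply: ereal_sup_ubound; exists n => //; exists [set c j | j in [set: 'I_n]].
split=> [_ [j _ <-]//||]; last by exists p => _ [j _ <-].
rewrite (card_eq_trans (inj_card_eq _)) 1?card_eq_sym ?card_II//.
by move=> i j _ _; apply: c_inj.
Qed.

Lemma multiplicity_le U n :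
  (forall p, exists c : 'I_n -> set X,
     forall A, U A -> A p -> exists j, A = c j) ->
  [set: X] !=set0 ->
  (multiplicity U <= (n%:R)%:E)%E.
Proof.
move=> cU [x0 _]; rewrite /multiplicity ge_max lee_fin ler0n/=.
apply: ge_ereal_sup => _ [k [V [VU Vk [p Vp]]] <-].
rewrite lee_fin ler_nat; have [c cA] := cU p.
rewrite -(@card_le_II k n) -(card_le_eql Vk) (card_le_eqr card_II).
apply: card_le_trans (card_image_le c _); apply: subset_card_le => A VA.
by have [j ->] := cA A (VU _ VA) (Vp _ VA); exists j.
Qed.

End Covers.

(** * The Lebesgue covering theorem on a grid *)

Section Grid.
Context {R : realType} (X : metricType R).

(** A colour, being a member of the cover, has a diameter at most [D], so in a
    box of side [N + 1] with [s * (N + 1) > D] it cannot meet two opposite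
    faces: [f] keeps opposite faces apart in proportion to the side of the
    box. The label of a point is the first coordinate whose zero face its
    colour misses, or [n] if there is none. Distinct labels come from distinct
    colours, and as [f] sends the vertices of a simplex within [s] of its
    first vertex, their colours all contain the image of that vertex. *)
Lemma multiplicity_grid (n : nat) (s lambda : R) (f : (nat -> nat) -> X)
    (U : set (set X)) : 0 < s -> s < lambda ->
  (forall v w, (forall i, (i < n)%N -> (v i <= w i <= (v i).+1)%N) ->
     mdist (f v) (f w) <= s) ->
  (forall v w i, (i < n)%N -> w i = 0%N ->
     s * (v i)%:R <= mdist (f v) (f w)) ->
  uniformly_bounded U -> (lambda%:E <= lebesgue_number U)%E ->
  (((n.+1)%:R)%:E <= multiplicity U)%E.
Proof.
move=> s0 sl f_close f_far /uniformly_boundedP[D UD] lU.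
have /choice[col /all_and2[Ucol col_ball]] :
    forall p, exists A, U A /\ forall q, mdist p q <= s -> A q.
  by move=> p; have [A] := lebesgue_number_gt sl lU p; exists A.
have col_refl p : col p p by apply: col_ball; rewrite mdistxx ltW.
pose N := Num.Def.truncn (D / s).
have sND : D < s * N.+1%:R.
  by rewrite mulrC -ltr_pdivrMr// truncnS_gt.
pose misses v i := `[< ~ exists2 w : nat -> nat,
  w i = 0%N & col (f w) = col (f v) >].
pose l v := find (misses v) (iota 0 n).
have [|x [t l_inj]] := @kuhn_lemma l N n (fun=> 0%N).
  move=> v _ _; split=> [|i ni].
    by rewrite -[X in (_ <= X)%N](size_iota 0) find_size.
  split=> [vi li|vi].
    have := @nth_find _ 0%N (misses v) (iota 0 n).
    rewrite has_find size_iota -/(l v) li ni nth_iota// add0n => /(_ isT).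
    by move=> /asboolP; apply; exists v.
  rewrite leqNgt; apply/negP => /(before_find 0%N).
  rewrite nth_iota// add0n => /asboolP; apply => -[w wi wv].
  have := f_far v w i ni wi; rewrite vi => /(lt_le_trans sND).
  rewrite ltNge => /negP; apply; apply: (UD _ (Ucol (f v))) => //.
  by rewrite -wv.
pose vtx := kuhn_vertex (fun=> 0%N) x t.
apply: (@multiplicity_ge _ _ _ n.+1 (fun j => col (f (vtx j))) (f (vtx 0%N)))
  => [i j ij|//|j].
  apply: l_inj; congr find; apply/funext => k.
  by rewrite /misses /= ij.
apply: col_ball; rewrite metric_sym; apply: f_close => i ni.
exact: kuhn_vertex_close.
Qed.

End Grid.

(** * Lattices in the space of finite sequences *)

Section Lattice.
Context {R : realType}.

Definition rcoord (u : Rfin R) (i : nat) : R := (u : {fsfun nat -> R with 0}) i.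

Lemma coord_le_mdist (u v : Rfin R) i : `|rcoord u i - rcoord v i| <= mdist u v.
Proof.
have [iuv|] := boolP (i \in (finsupp u `|` finsupp v)%fset).
  exact: (@le_bigmax_seq _ R _ _ 0 i xpredT
    (fun j => `|rcoord u j - rcoord v j|) iuv isT).
rewrite in_fsetU negb_or => /andP[iu iv].
by rewrite /rcoord !fsfun_dflt// subrr normr0 mdist_ge0.
Qed.

Lemma mdist_le_coord (u v : Rfin R) (e : R) : 0 <= e ->
  (forall i, `|rcoord u i - rcoord v i| <= e) -> mdist u v <= e.
Proof. by move=> e0 uve; apply: bigmax_le. Qed.

Lemma mdist_lattice_le k n (u v : Rfin R) (e : R) : 0 <= e ->
  lattice R k n u -> lattice R k n v ->
  (forall i, (i < n)%N -> `|rcoord u i - rcoord v i| <= e) -> mdist u v <= e.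
Proof.
move=> e0 [_ u0] [_ v0] uve; apply: mdist_le_coord => // i.
have [/uve//|ni] := ltnP i n.
by rewrite /rcoord u0// v0// subrr normr0.
Qed.

Lemma mdist_lattice_ge k n (u v : Rfin R) :
  lattice R k n u -> lattice R k n v -> u <> v -> 2 ^+ k <= mdist u v.
Proof.
move=> [uZ u0] [vZ v0] uv.
have [i uvi] : exists i, rcoord u i != rcoord v i.
  apply: contrapT => /forallNP uvE; apply: uv; apply/fsfunP => i.
  by apply/eqP; have /negP := uvE i; rewrite negbK.
apply: le_trans (coord_le_mdist u v i); move: uvi; rewrite /rcoord.
have [ni|ni] := ltnP i n; last by rewrite u0// v0// eqxx.
have [[a ->] [b ->]] := (uZ i ni, vZ i ni).
rewrite -subr_eq0 -mulrBr -intrB mulf_eq0 negb_or intr_eq0 => /andP[_ ab].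
rewrite normrM ger0_norm ?exprn_ge0// ler_peMr ?exprn_ge0//.
by rewrite -intr_norm ler1z; move: ab; lia.
Qed.

Definition grid_point (k n : nat) (v : nat -> nat) : Rfin R :=
  [fsfun i in [fset i | i in iota 0 n]%fset => 2 ^+ k * (v i)%:R | 0].

Lemma coord_grid_point k n v i :
  rcoord (grid_point k n v) i = if (i < n)%N then 2 ^+ k * (v i)%:R else 0.
Proof.
by rewrite /rcoord fsfunE !inE/= mem_iota add0n.
Qed.

Lemma lattice_grid_point k n v : lattice R k n (grid_point k n v).
Proof.
split=> i ni; rewrite -/(rcoord (grid_point k n v) i) coord_grid_point.
  by rewrite ni; exists (v i : int).
by rewrite ltnNge ni.
Qed.

Lemma grid_point_close k n v w :
  (forall i, (i < n)%N -> (v i <= w i <= (v i).+1)%N) ->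
  mdist (grid_point k n v) (grid_point k n w) <= 2 ^+ k.
Proof.
move=> vw; apply: (mdist_lattice_le _ (lattice_grid_point k n v)
  (lattice_grid_point k n w)).
  exact: exprn_ge0.
move=> i ni; rewrite !coord_grid_point ni -mulrBr normrM ger0_norm ?exprn_ge0//.
rewrite ler_piMr ?exprn_ge0//; have /andP[vwi] := vw i ni.
rewrite -(ler_nat R) -natr1; move: vwi; rewrite -(ler_nat R) ler_norml; lra.
Qed.

Lemma grid_point_far k n v w i : (i < n)%N -> w i = 0%N ->
  2 ^+ k * (v i)%:R <= mdist (grid_point k n v) (grid_point k n w).
Proof.
move=> ni wi; apply: le_trans (coord_le_mdist _ _ i).
by rewrite !coord_grid_point ni wi mulr0 subr0 ler_norm.
Qed.

Lemma floor_divB_le (s a b : R) : 0 < s ->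
  Num.floor (a / s) = Num.floor (b / s) -> `|a - b| <= s.
Proof.
move=> s0 ab.
have /andP[] := floor_itv (a / s); have /andP[] := floor_itv (b / s).
rewrite ab; set z := Num.floor _.
rewrite !ler_pdivlMr// !ltr_pdivrMr// intrD1 !mulrDl mul1r ler_norml.
by move: (_ * s) => y; lra.
Qed.

(** [u] and [v] lie in the same cube of side [(n + 1) * w] of the [j]-th
    tiling, which is the standard one shifted by [j * w] in every direction.
    *)
Definition tile (n j : nat) (w : R) (u v : Rfin R) := forall i, (i < n)%N ->
  Num.floor ((rcoord v i - j%:R * w) / (n.+1%:R * w)) =
  Num.floor ((rcoord u i - j%:R * w) / (n.+1%:R * w)).

(** The walls of two different tilings are at least [2 * r] apart in each
    coordinate, so a coordinate of [u] can be within [r] of the walls of only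
    one tiling; [n] coordinates cannot spoil all [n + 1] tilings. *)
Lemma tile_good_index n (r : R) (u : Rfin R) : 0 < r ->
  exists j : 'I_n.+1, forall i, (i < n)%N -> forall q : int,
    r <= `|rcoord u i - j%:R * (2 * r) - q%:~R * (n.+1%:R * (2 * r))|.
Proof.
move=> r0; apply: contrapT => /forallNP bad.
have /choice[h hP] : forall j : 'I_n.+1, exists i : 'I_n, exists q : int,
    `|rcoord u i - j%:R * (2 * r) - q%:~R * (n.+1%:R * (2 * r))| < r.
  move=> j; apply: contrapT => /forallNP good; apply: (bad j) => i ni q.
  rewrite leNgt; apply/negP => lt_r; apply: (good (Ordinal ni)).
  by exists q.
have : injective h.
  move=> j j' hj; have [[q qj] [q' qj']] := (hP j, hP j').
  rewrite -hj in qj'; set c := rcoord u _ in qj qj'.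
  have jj' : `|(Posz j - Posz j' + (q - q') * n.+1)%:~R : R| < 1.
    rewrite -(ltr_pM2r (_ : 0 < 2 * r)) ?mulr_gt0// mul1r.
    have -> : `|(Posz j - Posz j' + (q - q') * n.+1)%:~R : R| * (2 * r) =
      `|(c - j'%:R * (2 * r) - q'%:~R * (n.+1%:R * (2 * r))) -
        (c - j%:R * (2 * r) - q%:~R * (n.+1%:R * (2 * r)))|.
      rewrite -[X in _ * X]gtr0_norm ?mulr_gt0// -normrM; congr `|_|.
      by rewrite rmorphD rmorphM !rmorphB /= -!pmulrn; ring.
    apply: le_lt_trans (ler_normB _ _) _; lra.
  apply: val_inj => /=; move: jj'; rewrite -intr_norm ltrz1.
  have := ltn_ord j; have := ltn_ord j'; clear.
  move: (nat_of_ord j) (nat_of_ord j').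
  move=> a b bn an ab1.
  have ab : Posz a - Posz b + (q - q') * n.+1%:Z = 0 by lia.
  have [z0|[z0|z0]] : (q - q' <= -1) \/ (q - q' = 0) \/ (1 <= q - q') by lia.
  - have : (q - q') * n.+1%:Z <= -1 * n.+1%:Z by rewrite ler_pM2r.
    lia.
  - by move: ab; rewrite z0; lia.
  - have : 1 * n.+1%:Z <= (q - q') * n.+1%:Z by rewrite ler_pM2r.
    lia.
move=> /leq_card; rewrite !card_ord; lia.
Qed.

End Lattice.

(** * The asymptotic dimension function of a lattice *)

Section LatticeAd.
Context {R : realType}.

Lemma ad_le (X : metricType R) (lambda : R) (n : nat) (U : set (set X)) :
  \bigcup_(A in U) A = [set: X] -> uniformly_bounded U ->
  (lambda%:E <= lebesgue_number U)%E -> (multiplicity U <= (n.+1%:R)%:E)%E ->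
  (ad X lambda <= (n%:R)%:E)%E.
Proof.
move=> Uc Ub Ul Um; rewrite /ad leeBlDr// -EFinD natr1.
by apply: le_trans Um; apply: ereal_inf_lbound; exists U.
Qed.

Lemma ad_grid (X : metricType R) (n : nat) (s lambda : R)
    (f : (nat -> nat) -> X) : 0 < s -> s < lambda ->
  (forall v w, (forall i, (i < n)%N -> (v i <= w i <= (v i).+1)%N) ->
     mdist (f v) (f w) <= s) ->
  (forall v w i, (i < n)%N -> w i = 0%N ->
     s * (v i)%:R <= mdist (f v) (f w)) ->
  ((n%:R)%:E <= ad X lambda)%E.
Proof.
move=> s0 sl fc ff; rewrite /ad leeBrDr// -EFinD natr1.
apply: le_ereal_inf_tmp => _ [U [Uc Ub Ul] <-].
exact: (multiplicity_grid s0 sl fc ff).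
Qed.

Definition submetric_point (X : metricType R) (A : set X) (u : X) (uA : A u) :
  submetric A := exist (fun x => x \in A) u (mem_set uA).

Variables (k n : nat).
Let L := submetric (lattice R k n).

Let latP (u : L) : lattice R k n (val u). Proof. exact: set_mem (valP u). Qed.

Let L0 : [set: L] !=set0.
Proof. by exists (submetric_point (lattice_grid_point k n (fun=> 0%N))). Qed.

Lemma ad_lattice_ge (r : R) : 2 ^+ k < r -> ((n%:R)%:E <= ad L r)%E.
Proof.
move=> kr; pose f v : L := submetric_point (lattice_grid_point k n v).
apply: (@ad_grid _ n (2 ^+ k) r f) => //.
- exact: grid_point_close.
- exact: grid_point_far.
Qed.

Lemma ad_lattice_small (r : R) : 0 < r -> r <= 2 ^+ k -> (ad L r <= 0)%E.
Proof.
move=> r0 rk; apply: (@ad_le _ _ 0 [set [set u] | u in [set: L]]).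
- by apply/seteqP; split=> // u _; exists [set u] => //; exists u.
- apply/uniformly_boundedP; exists 0 => _ [u _ <-] p q -> ->.
  by rewrite mdistxx.
- apply: lebesgue_number_ge => // p; exists [set p]; first by exists p.
  move=> q pq; apply: contrapT => qp.
  have := lt_le_trans pq rk; rewrite ltNge => /negP; apply.
  by apply: (mdist_lattice_ge (latP p) (latP q)) => /val_inj/esym.
- apply: multiplicity_le => // p; exists (fun=> [set p]) => _ [u _ <-] ->.
  by exists ord0.
Qed.

Lemma ad_lattice_le (r : R) : 0 < r -> (ad L r <= (n%:R)%:E)%E.
Proof.
move=> r0; pose w := 2 * r; have w0 : 0 < w by rewrite mulr_gt0.
pose P := n.+1%:R * w; have P0 : 0 < P by rewrite mulr_gt0.
pose T (j : nat) (u : L) : set L := [set v | tile n j w (val u) (val v)].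
apply: (@ad_le _ _ n [set A | exists (j : 'I_n.+1) (u : L), A = T j u]).
- apply/seteqP; split=> // u _; exists (T 0%N u); last by [].
  by exists ord0, u.
- apply/uniformly_boundedP; exists P => _ [j [u ->]] p q up uq.
  apply: (mdist_lattice_le (ltW P0) (latP p) (latP q)) => i ni.
  have := uq i ni; rewrite -(up i ni) -/P => /esym/(floor_divB_le P0).
  by rewrite opprB addrA subrK.
- apply: lebesgue_number_ge => // p.
  have [j jP] := tile_good_index n (val p) r0.
  exists (T j p); first by exists j, p.
  move=> q pq i ni; rewrite -/P.
  have := le_lt_trans (coord_le_mdist (val p) (val q) i) pq.
  have := jP i ni; rewrite -/w -/P.
  set a := rcoord (val p) i; set b := rcoord (val q) i => aP ab.
  set m := RHS; apply/floor_def.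
  have /andP[] := floor_itv ((a - j%:R * w) / P); rewrite -/m.
  have := aP m; have := aP (m + 1).
  rewrite !ler_pdivlMr// !ltr_pdivrMr// intrD1 !mulrDl mul1r.
  move: ab; move: (m%:~R * P) => z.
  rewrite ltr_norml !ler_normr; lra.
- apply: multiplicity_le => // p; exists (fun j : 'I_n.+1 => T j p).
  move=> _ [j [u ->]] up; exists j; apply/seteqP; split=> v uv i ni.
    by rewrite uv// -up.
  by rewrite uv// up.
Qed.

Lemma ad_latticeP (r : R) : (0 < n)%N -> 0 < r ->
  ad L r = (n%:R)%:E <-> 2 ^+ k < r.
Proof.
move=> n0 r0; split=> [adn|kr]; last first.
  by apply/eqP; rewrite eq_le ad_lattice_le// ad_lattice_ge.
rewrite ltNge; apply/negP => /(ad_lattice_small r0).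
by rewrite adn lee_fin lern0 eqn0Ngt n0.
Qed.

End LatticeAd.

(** * The exponents of the summands *)

Section Gtilde.
Context {R : realType} (g : R -> nat).

Lemma expn2_lt_bound (r : R) k : 2 ^+ k < r -> (k <= Num.truncn r)%N.
Proof.
move=> kr; have r0 : 0 <= r by rewrite (le_trans _ (ltW kr))// exprn_ge0.
rewrite truncn_ge_nat//; apply: ltW; apply: lt_trans kr.
by rewrite -natrX ltr_nat ltn_expl.
Qed.

(** The value 0 is the default of the definition, taken when no exponent is
    admissible. *)
Lemma gtilde_eq0_or_lt (r : R) : 0 < r -> (0 < g r)%N ->
  gtilde g r = 0%N \/ 2 ^+ gtilde g r < r.
Proof.
move=> r0 gr0; rewrite /gtilde.
case: xgetP => [k _ [[_ adk] _]|_]; last by left.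
by right; apply/ad_latticeP; first exact: gr0.
Qed.

Lemma gtilde_ge (r : R) k : (0 < k)%N -> 2 ^+ k < r -> (0 < g r)%N ->
  (k <= gtilde g r)%N.
Proof.
move=> k0 kr gr0; have r0 : 0 < r by rewrite (lt_trans _ kr)// exprn_gt0.
pose P j := (0 < j)%N && (2 ^+ j < r).
have P_bound j : P j -> (j <= Num.truncn r)%N by case/andP => _ /expn2_lt_bound.
have exP : exists j, P j by exists k; apply/andP.
have [m /andP[m0 mr] m_max] := ex_maxnP exP P_bound.
pose S := [set j : nat | (0 < j)%N /\
  ad (submetric (lattice R j (g r))) r = ((g r)%:R)%:E].
have SP j : S j <-> P j.
  split=> [[j0 /ad_latticeP]|/andP[j0 jr]]; last first.
    by split=> //; apply/ad_latticeP.
  by move=> /(_ gr0 r0) jr; apply/andP.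
have : exists m, [set k | S k /\ ubound S k] m.
  exists m; split=> [|j /SP/m_max//]; first by apply/SP/andP.
by move=> /(xgetPex 0%N)[_]; apply; apply/SP/andP.
Qed.

End Gtilde.

(** * Finite decomposition of finite-dimensional families *)

Section Decomposition.
Context {R : realType}.

(** The spaces that [M] functions embed in dimension [M] up to an error [D].
    Unlike a family of subsets of a given space, this family is stable under
    passing to subspaces, whose types change at every decomposition step. *)
Definition coordinatized (M : nat) (D : R) : metric_family R := fun Y =>
  exists c : nat -> Y -> R,
    (forall j, (j < M)%N -> forall x y, `|c j x - c j y| <= mdist x y) /\
    (forall x y, mdist x y <= D + \sum_(j < M) `|c j x - c j y|).

Lemma set_dist_gt (Y : metricType R) (A B : set Y) (r s : R) : r < s ->
  (forall x y, A x -> B y -> s <= mdist x y) -> (r%:E < set_dist A B)%E.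
Proof.
move=> rs sAB; apply: (@lt_le_trans _ _ s%:E); first by rewrite lte_fin.
by apply: le_ereal_inf_tmp => _ [[x y] [/= Ax By] <-]; rewrite lee_fin sAB.
Qed.

Lemma floor_divB_ge (s a b : R) : 0 < s ->
  Num.floor (a / s) + 2 <= Num.floor (b / s) -> s <= `|a - b|.
Proof.
move=> s0; rewrite -(ler_int R) intrD.
have /andP[_] := floor_itv (a / s); have /andP[+ _] := floor_itv (b / s).
rewrite intrD1 => bs as1 ab.
have : a / s + 1 <= b / s by move: bs as1 ab; lra.
rewrite -(ler_pM2r s0) mulrDl !divfK ?gt_eqF// mul1r distrC => ?.
by apply: le_trans (ler_norm _); lra.
Qed.

(** Cut along the last coordinate into slabs of width [r + 1], sorted by the
    parity of their index. Two slabs of the same parity are separated by a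
    slab of the other one, and within a slab the last coordinate varies by at
    most [r + 1], which is absorbed in the error. *)
Lemma decomposable_coordinatized M D (r : R) : 0 < r ->
  decomposable r (coordinatized M.+1 D) (coordinatized M (D + (r + 1))).
Proof.
move=> r0 Y [c [c_lip c_bd]]; pose s := r + 1.
have s0 : 0 < s by rewrite addr_gt0.
pose z x := Num.floor (c M x / s).
exists (fun b =>
  [set A | exists2 m : int, odd `|m|%N = b & A = z @^-1` [set m]]).
split=> [|b _ [m _ ->]|b _ _ [m mb ->] [m' m'b ->] mm'].
- apply/seteqP; split=> // x _; case E : (odd `|z x|%N); [right|left];
  by exists (z @^-1` [set z x]) => //; exists (z x).
- exists (fun j u => c j (val u)); split=> [j jM x y|x y].
    by apply: c_lip; rewrite ltnW.
  apply: le_trans (c_bd (val x) (val y)) _; rewrite big_ord_recr/= addrA.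
  rewrite [X in _ <= X]addrAC lerD2l; apply: floor_divB_le => //.
  have /= := set_mem (valP x); have /= := set_mem (valP y).
  by rewrite /z => -> ->.
- apply: (@set_dist_gt _ _ _ _ s); first by rewrite ltrDl.
  move=> x y zx zy; apply: le_trans (c_lip M _ x y) => //.
  have [] : z x + 2 <= z y \/ z y + 2 <= z x.
    have nmm' : m <> m' by move=> E; apply: mm'; rewrite E.
    rewrite zx zy; move: nmm' mb; rewrite -m'b; clear; lia.
  + exact: floor_divB_ge.
  + by rewrite distrC; apply: floor_divB_ge.
Qed.

Lemma fdc_coordinatized M D : fdc lt_omega1 (Some M) (coordinatized M D).
Proof.
elim: M D => [|M IHM] D; last first.
  apply: fdc_pos; first by exists (Some M); rewrite /= ltnS.
  move=> r r0; exists (Some M); first exact: ltnSn.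
  exists (coordinatized M (D + (r + 1))); first exact: IHM.
  exact: decomposable_coordinatized.
apply: fdc_zero => [[b|]//|].
apply: (@le_lt_trans _ _ D%:E); last exact: ltry.
apply: ge_ereal_sup => _ [Y [c [_ cD]] <-]; apply/diam_leP => p q _ _.
by have := cD p q; rewrite big_ord0 addr0.
Qed.

End Decomposition.

(** * The asymptotic union *)

Section XOmega.
Context {R : realType} (g : R -> nat).
Hypothesis g_pos : forall r : R, 0 < r -> (0 < g r)%N.
Hypothesis g_incr : forall r s : R, 0 < r -> r <= s -> (g r <= g s)%N.

Let level (x : X_omega g) : nat := (val x).1.
Let vec (x : X_omega g) : Rfin R := (val x).2.

Let mdist_omega (x y : X_omega g) :
  mdist x y = mdist (vec x) (vec y) + (as_gap (level x) (level y))%:R.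
Proof. by []. Qed.

Let level_gt0 x : (0 < level x)%N. Proof. by have [] := set_mem (valP x). Qed.

Let vec_in x : lattice R (gtilde g (level x)%:R) (g (level x)%:R) (vec x).
Proof. by have [] := set_mem (valP x). Qed.

Lemma as_gap_le l k m : (l < m)%N -> (k < m)%N -> (as_gap l k <= m * m)%N.
Proof.
move=> lm km; rewrite /as_gap.
apply: (@leq_trans (\sum_(minn l k <= j < maxn l k) m)).
  by rewrite !big_nat; apply: leq_sum => j; lia.
by rewrite sum_nat_const_nat leq_mul2r; lia.
Qed.

Lemma as_gap_ge l k : l != k -> (minn l k <= as_gap l k)%N.
Proof.
move=> lk; rewrite /as_gap big_ltn ?leq_addr//; move: lk; lia.
Qed.

(** Two points of the same summand differ by a multiple of [2 ^ gtilde] in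
    some coordinate, and [gtilde] is at least [K] beyond level [2 ^ K]; two
    points of different summands are separated by the gap. *)
Lemma omega_far K x y : (0 < K)%N -> x <> y ->
  (2 ^ K < level x)%N -> (2 ^ K < level y)%N -> 2 ^+ K <= mdist x y.
Proof.
move=> K0 xy Kx Ky; rewrite mdist_omega.
have [lxy|lxy] := eqVneq (level x) (level y); last first.
  apply: (@le_trans _ _ (as_gap (level x) (level y))%:R).
    rewrite -natrX ler_nat; apply: leq_trans (as_gap_ge lxy).
    by rewrite leq_min (ltnW Kx) (ltnW Ky).
  by rewrite lerDr mdist_ge0.
rewrite lxy as_gapxx addr0; have xL := vec_in x; rewrite lxy in xL.
apply: le_trans (mdist_lattice_ge xL (vec_in y) _); last first.
  move=> pxy; apply: xy; apply: val_inj; move: lxy pxy; rewrite /level /vec.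
  by case: (val x) (val y) => [? ?] [? ?] /= -> ->.
rewrite ler_weXn2l ?ler1n// gtilde_ge//.
  by rewrite -natrX ltr_nat.
by rewrite g_pos// ltr0n.
Qed.

(** At scale [r < 2 ^ K], one part consists of a single piece, the summands up
    to level [2 ^ K], and the other part of all remaining singletons. *)
Lemma D_omega_X_omega : D_omega (single_family (X_omega g)).
Proof.
apply: fdc_pos => [|r r0]; first by exists (Some 0%N).
pose K := (Num.truncn r).+1; have rK : r < 2 ^+ K.
  apply: lt_trans (truncnS_gt r) _; by rewrite -natrX ltr_nat ltn_expl.
(* the first [N - 1] summands have dimension at most [g N], and the gaps between
   them are at most [N * N] *)
pose N := (2 ^ K).+1; pose M := g N%:R; pose D : R := (N * N)%:R.
exists (Some M) => //.
exists (coordinatized M D); first exact: fdc_coordinatized.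
move=> _ ->; pose low := [set x : X_omega g | (level x < N)%N].
exists (fun b =>
  if b then [set A | exists2 x, ~ low x & A = [set x]] else [set low]).
split=> [|[] A|[] A B].
- apply/seteqP; split=> // x _; have [xl|xl] := pselect (low x).
    by left; exists low.
  by right; exists [set x] => //; exists x.
- move=> [x _ ->]; exists (fun _ _ => 0); split=> [j _ u v|u v].
    by rewrite subrr normr0 mdist_ge0.
  have -> : u = v.
    by apply: val_inj; rewrite (set_mem (valP u)) (set_mem (valP v)).
  by rewrite mdistxx addr_ge0// sumr_ge0.
- move=> ->; exists (fun j u => rcoord (vec (val u)) j); split=> [j _ u v|u v].
    apply: le_trans (coord_le_mdist _ _ _) _.
    by rewrite [mdist u v]mdist_omega lerDl.
  have uN := set_mem (valP u); have vN := set_mem (valP v).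
  rewrite [mdist u v]mdist_omega addrC lerD ?ler_nat ?as_gap_le//.
  apply: mdist_le_coord => [|i]; first exact: sumr_ge0.
  have [iM|Mi] := ltnP i M.
    by rewrite (bigD1 (Ordinal iM))//= lerDl sumr_ge0.
  have zero w : (level w < N)%N -> rcoord (vec w) i = 0.
    move=> wN; have [_] := vec_in w; apply; apply: leq_trans Mi.
    by rewrite g_incr ?ltr0n// ler_nat ltnW.
  by rewrite !zero// subrr normr0 sumr_ge0.
- move=> [x xl ->] [y yl ->] xy; apply: (set_dist_gt rK) => _ _ -> ->.
  apply: omega_far => //; first by move=> E; apply: xy; rewrite E.
  + by move/negP: xl; rewrite -leqNgt.
  + by move/negP: yl; rewrite -leqNgt.
- by move=> -> ->.
Qed.

(** The [i]-th summand, for the least [i >= r], is an isometrically embedded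
    lattice of step less than [r] and dimension [g i >= g r]. *)
Lemma ad_X_omega_ge (r : R) : 1 < r -> (((g r)%:R)%:E <= ad (X_omega g) r)%E.
Proof.
move=> r1; have r0 : 0 < r by apply: lt_trans r1.
have exN : exists i, r <= i%:R.
  by exists (Num.truncn r).+1; rewrite ltW ?truncnS_gt.
have [i ri i_min] := ex_minnP exN.
have i0 : (0 < i)%N by rewrite -(ltr0n R) (lt_le_trans r0).
have iR0 : 0 < i%:R :> R by rewrite ltr0n.
have kr : 2 ^+ gtilde g i%:R < r.
  have [->|] := gtilde_eq0_or_lt iR0 (g_pos iR0); first by rewrite expr0.
  rewrite -natrX ltr_nat => ki; rewrite ltNge; apply/negP => /i_min.
  by rewrite leqNgt ki.
apply: (@le_trans _ _ ((g i%:R)%:R)%:E).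
  by rewrite lee_fin ler_nat g_incr.
pose k := gtilde g i%:R; pose n := g i%:R.
pose f v : X_omega g :=
  exist (fun p => p \in _) (i, _)
    (mem_set (conj i0 (lattice_grid_point k n v))).
have mdist_f v w :
    mdist (f v) (f w) = mdist (grid_point k n v) (grid_point k n w).
  by rewrite mdist_omega /= as_gapxx addr0.
apply: (@ad_grid _ _ _ (2 ^+ gtilde g i%:R) r f) => // [v w vw|v w j jn wj].
  by rewrite mdist_f grid_point_close.
by rewrite mdist_f grid_point_far.
Qed.

End XOmega.

Theorem proposition5p3 (R : realType) (g : R -> nat)
    (g_pos : forall r : R, 0 < r -> (0 < g r)%N)
    (g_incr : forall r s : R, 0 < r -> r <= s -> (g r <= g s)%N)
    (g_lim : g r @[r --> +oo] --> \oo) :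
  D_omega (single_family (X_omega g)) /\
  forall r : R, 1 < r -> (((g r)%:R)%:E <= ad (X_omega g) r)%E.
Proof.
split; first exact: D_omega_X_omega.
by move=> r; apply: ad_X_omega_ge.
Qed.
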